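(* Let $\beta: I\to M\subset G^3$ be a unit-speed curve on a surface $M$ in the Galilean space $G^3$, with geodesic torsion $\tau_g$, which is a geodesic ($\kappa_g\equiv0$) and a Salkowski curve (its curvature $\kappa$ is constant and its torsion $\tau$ is not constant). Then its position vector is given by $$\beta(x)=\Bigg(x,\ m\int\!\!\int\Big(\cos\Big(\int\tau_g(x)dx\Big)+m_1\Big)dx\,dx,\ -m\int\!\!\int\Big(\sin\Big(\int\tau_g(x)dx\Big)+m_2\Big)dx\,dx\Bigg),$$ where $m,m_1,m_2$ are constants.
   Context: The Galilean space $G^3$ is $\mathbb R^3$ with the scalar product $\mathbf v\cdot_G\mathbf w=v_1w_1$ if $v_1\ne0$ or $w_1\neq 0$, and $\mathbf v\cdot_G\mathbf w=v_2w_2+v_3w_3$ if $v_1=w_1=0$; the norm is $\|\mathbf v\|_G=\sqrt{|\mathbf v\cdot_G\mathbf v|}$ and the cross product is $\mathbf v\times_G\mathbf w=(0,\,v_3w_1-v_1w_3,\,v_1w_2-v_2w_1)$. A unit-speed curve (parametrized by arc length) is one of the form $\beta(x)=(x,y(x),z(x))$, $x\in I\subset\mathbb R$. Its curvature is $\kappa=\|\beta''\|_G$, assumed positive, and its torsion is $\tau=\det(\beta',\beta'',\beta''')/\kappa^2$. $M$ is oriented; the Darboux frame of $\beta$ with respect to $M$ is $\{\mathbf T,\mathbf Q,\mathbf n\}$ with $\mathbf T=\beta'$, $\mathbf n$ the unit normal of $M$ along $\beta$ (a vector field with first component $0$), and $\mathbf Q=\mathbf n\times_G\mathbf T$. The geodesic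 curvature $\kappa_g$, normal curvature $\kappa_n$ and geodesic torsion $\tau_g$ are the functions in $\mathbf T'=\kappa_g\mathbf Q+\kappa_n\mathbf n$, $\mathbf Q'=\tau_g\mathbf n$, $\mathbf n'=-\tau_g\mathbf Q$. The symbol $\int g(x)\,dx$ denotes an antiderivative of $g$, the constants of integration being suitably chosen. *)

(* Defs.v *)
From Stdlib Require Import Reals.
From Coquelicot Require Import Coquelicot.
Open Scope R_scope.

Notation vec3 := (R * R * R)%type.

Definition c1 (v : vec3) : R := fst (fst v).
Definition c2 (v : vec3) : R := snd (fst v).
Definition c3 (v : vec3) : R := snd v.

Definition gdot (v w : vec3) : R :=
  if Req_EM_T (c1 v) 0 then
    if Req_EM_T (c1 w) 0 then c2 v * c2 w + c3 v * c3 w else c1 v * c1 w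
  else c1 v * c1 w.

Definition gnorm (v : vec3) : R := sqrt (Rabs (gdot v v)).

Definition gcross (v w : vec3) : vec3 :=
  (0, c3 v * c1 w - c1 v * c3 w, c1 v * c2 w - c2 v * c1 w).

Definition det3 (u v w : vec3) : R :=
  c1 u * (c2 v * c3 w - c3 v * c2 w)
  - c2 u * (c1 v * c3 w - c3 v * c1 w)
  + c3 u * (c1 v * c2 w - c2 v * c1 w).

Definition is_open_interval (I : R -> Prop) : Prop :=
  open I /\ (forall a b x, I a -> I b -> a <= x <= b -> I x).

Definition class_C (k : nat) (I : R -> Prop) (f : R -> R) : Prop :=
  forall x, I x ->
    (forall j, (j <= k)%nat -> ex_derive_n f j x) /\
    continuous (Derive_n f k) x.

Definition curve_class_C (k : nat) (I : R -> Prop) (b : R -> vec3) : Prop :=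
  class_C k I (fun x => c1 (b x)) /\
  class_C k I (fun x => c2 (b x)) /\
  class_C k I (fun x => c3 (b x)).

Definition curve_derive (b : R -> vec3) (x : R) : vec3 :=
  (Derive (fun t => c1 (b t)) x,
   Derive (fun t => c2 (b t)) x,
   Derive (fun t => c3 (b t)) x).

(** C^3 is the least regularity for which curvature and torsion are
    defined and continuous. *)
Definition unit_speed_curve (I : R -> Prop) (b : R -> vec3) : Prop :=
  curve_class_C 3 I b /\ (forall x, I x -> c1 (b x) = x).

Definition curvature (b : R -> vec3) (x : R) : R :=
  gnorm (curve_derive (curve_derive b) x).

Definition torsion (b : R -> vec3) (x : R) : R :=
  det3 (curve_derive b x)
       (curve_derive (curve_derive b) x)
       (curve_derive (curve_derive (curve_derive b)) x)
  / (curvature b x) ^ 2.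

Definition constant_on (I : R -> Prop) (f : R -> R) : Prop :=
  exists c, forall x, I x -> f x = c.

Definition Salkowski (I : R -> Prop) (b : R -> vec3) : Prop :=
  constant_on I (curvature b) /\ ~ constant_on I (torsion b).

Definition D1 (f : R * R -> R) (q : R * R) : R :=
  Derive (fun s => f (s, snd q)) (fst q).
Definition D2 (f : R * R -> R) (q : R * R) : R :=
  Derive (fun t => f (fst q, t)) (snd q).

Fixpoint class_C_2d (k : nat) (U : R * R -> Prop) (f : R * R -> R) : Prop :=
  (forall q, U q -> continuous f q) /\
  match k with
  | O => True
  | S k' =>
      (forall q, U q ->
         ex_derive (fun s => f (s, snd q)) (fst q) /\
         ex_derive (fun t => f (fst q, t)) (snd q)) /\
      class_C_2d k' U (D1 f) /\ class_C_2d k' U (D2 f)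
  end.

Definition tangent1 (phi : R * R -> vec3) (q : R * R) : vec3 :=
  (D1 (fun p => c1 (phi p)) q, D1 (fun p => c2 (phi p)) q,
   D1 (fun p => c3 (phi p)) q).
Definition tangent2 (phi : R * R -> vec3) (q : R * R) : vec3 :=
  (D2 (fun p => c1 (phi p)) q, D2 (fun p => c2 (phi p)) q,
   D2 (fun p => c3 (phi p)) q).

(** [phi] is a regular parametrization, with parameter domain [U], of a
    relatively open part of [M]: an immersion of class C^2 that is a
    homeomorphism onto [M] intersected with an open set [V]. *)
Definition is_patch (M : vec3 -> Prop) (U : R * R -> Prop)
    (phi : R * R -> vec3) : Prop :=
  open U /\
  class_C_2d 2 U (fun q => c1 (phi q)) /\
  class_C_2d 2 U (fun q => c2 (phi q)) /\
  class_C_2d 2 U (fun q => c3 (phi q)) /\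
  (forall q a b, U q ->
     plus (scal a (tangent1 phi q)) (scal b (tangent2 phi q)) = zero ->
     a = 0 /\ b = 0) /\
  (exists (V : vec3 -> Prop) (psi : vec3 -> R * R),
     open V /\
     (forall p, (M p /\ V p) <-> exists q, U q /\ phi q = p) /\
     (forall q, U q -> psi (phi q) = q) /\
     (forall p, M p -> V p ->
        filterlim psi (within M (locally p)) (locally (psi p)))).

(** [a * d - b * c] is the Jacobian determinant of the change of
    parameters from [phi] to [phi'] at the common point. *)
Definition same_orientation (phi : R * R -> vec3) (q : R * R)
    (phi' : R * R -> vec3) (q' : R * R) : Prop :=
  exists a b c d : R,
    tangent1 phi q
      = plus (scal a (tangent1 phi' q')) (scal b (tangent2 phi' q')) /\
    tangent2 phi q
      = plus (scal c (tangent1 phi' q')) (scal d (tangent2 phi' q')) /\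
    0 < a * d - b * c.

(** The orientation of [M] is the atlas [A]: [A U phi] says that [phi],
    with domain [U], is one of its patches. *)
Definition is_oriented_surface (M : vec3 -> Prop)
    (A : (R * R -> Prop) -> (R * R -> vec3) -> Prop) : Prop :=
  (forall U phi, A U phi -> is_patch M U phi) /\
  (forall p, M p -> exists U phi q, A U phi /\ U q /\ phi q = p) /\
  (forall U phi U' phi' q q',
     A U phi -> A U' phi' -> U q -> U' q' -> phi q = phi' q' ->
     same_orientation phi q phi' q').

(** The Galilean cross product of the tangent vectors vanishes exactly when
    the tangent plane is parallel to [x = 0]; no unit normal exists there.
    This never happens along a unit-speed curve, whose velocity has first
    component 1. *)
Definition is_unit_normal (A : (R * R -> Prop) -> (R * R -> vec3) -> Prop)
    (p n : vec3) : Prop :=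
  exists U phi q,
    A U phi /\ U q /\ phi q = p /\
    let w := gcross (tangent1 phi q) (tangent2 phi q) in
    0 < gnorm w /\ n = scal (/ gnorm w) w.

Definition is_normal_along (A : (R * R -> Prop) -> (R * R -> vec3) -> Prop)
    (I : R -> Prop) (b n : R -> vec3) : Prop :=
  forall x, I x -> is_unit_normal A (b x) (n x).

Definition frame_Q (b n : R -> vec3) (x : R) : vec3 :=
  gcross (n x) (curve_derive b x).

Definition Darboux_equations (I : R -> Prop) (b n : R -> vec3)
    (kg kn tg : R -> R) : Prop :=
  forall x, I x ->
    is_derive (curve_derive b) x
      (plus (scal (kg x) (frame_Q b n x)) (scal (kn x) (n x))) /\
    is_derive (frame_Q b n) x (scal (tg x) (n x)) /\
    is_derive n x (scal (- tg x) (frame_Q b n x)).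

(** Only determined up to an additive constant, so two occurrences of the
    same indefinite integral may stand for different [F]. *)
Definition is_antiderivative (I : R -> Prop) (g F : R -> R) : Prop :=
  forall x, I x -> is_derive F x (g x).

(* Main.v *)
(** For a geodesic the tangent satisfies [T' = kappa_n n], so constancy of the
    curvature makes [kappa_n] a constant [m]: it is differentiable, does not
    vanish, and its square is constant.  The unit normal [(0, n2, n3)] satisfies
    [n2' = - tau_g n3] and [n3' = tau_g n2], hence equals
    [(0, cos Phi, sin Phi)] for an antiderivative [Phi] of [tau_g], and
    [beta'' = m n] is integrated twice.  The minus sign in the third component
    is absorbed by [Psi = Phi + PI]. *)

From Stdlib Require Import Reals Lra Classical.
From Coquelicot Require Import Coquelicot.
(* Imported last: [Reals] has a projection [c1] that would shadow ours. *)
Require Import Defs.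
Open Scope R_scope.

(** * Antiderivatives on an open interval and the angle of a rotating unit vector *)

Lemma zero_derivative_constant (I : R -> Prop) (f : R -> R) :
  is_open_interval I -> (forall x, I x -> is_derive f x 0) ->
  forall x y, I x -> I y -> f x = f y.
Proof.
intros [_ HI] Hf.
assert (H : forall x y, I x -> I y -> x < y -> f x = f y).
{ intros x y Hx Hy Hxy. apply eq_is_derive; [|exact Hxy].
  intros t Ht. apply Hf. exact (HI x y t Hx Hy Ht). }
intros x y Hx Hy. destruct (Rtotal_order x y) as [L|[E|L]].
- now apply H.
- now rewrite E.
- symmetry. now apply H.
Qed.

(** The integral from [x0] works, since convexity keeps every segment from [x0] inside [I]. The
    prescribed value [c] later matches the angle of the normal at a base point. *)
Lemma antiderivative_through (I : R -> Prop) (g : R -> R) (x0 c : R) :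
  is_open_interval I -> (forall x, I x -> continuous g x) -> I x0 ->
  exists F, is_antiderivative I g F /\ F x0 = c.
Proof.
intros [HO HI] Hg H0. exists (fun x => RInt g x0 x + c). split.
- intros x Hx. replace (g x) with (g x + 0) by ring.
  apply (is_derive_plus (V := R_NormedModule)); [|exact (is_derive_const (V := R_NormedModule) c x)].
  apply is_derive_RInt with x0; [|now apply Hg].
  apply (filter_imp I); [|exact (HO x Hx)].
  intros y Hy. apply (RInt_correct (V := R_CompleteNormedModule)).
  apply (ex_RInt_continuous (V := R_CompleteNormedModule)).
  intros z Hz. apply Hg. unfold Rmin, Rmax in Hz.
  destruct (Rle_dec x0 y); [apply (HI x0 y)|apply (HI y x0)]; auto.
- rewrite RInt_point. unfold zero; simpl. ring.
Qed.

(** [acos a] has cosine [a] and sine [Rabs b], so the sign of [b] decides between [acos a] and its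
    opposite. *)
Lemma unit_vector_angle (a b : R) :
  a * a + b * b = 1 -> exists t, cos t = a /\ sin t = b.
Proof.
intros H. assert (Ha : -1 <= a <= 1) by nra.
assert (Hs : sin (acos a) = Rabs b).
{ rewrite sin_acos by exact Ha. rewrite <- sqrt_Rsqr_abs. f_equal.
  unfold Rsqr. lra. }
destruct (Rle_dec 0 b) as [Hb|Hb].
- exists (acos a). rewrite Hs, cos_acos by exact Ha.
  split; [reflexivity|]. now apply Rabs_pos_eq.
- exists (- acos a). rewrite cos_neg, sin_neg, Hs, cos_acos by exact Ha.
  split; [reflexivity|]. rewrite Rabs_left by lra. ring.
Qed.

(** The equations say that the vector turns with angular speed [w], so its angle should be the
    antiderivative of [w] that starts from the right angle at one point. *)
Lemma rotating_unit_vector (I : R -> Prop) (u v w : R -> R) :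
  is_open_interval I -> (exists x0, I x0) ->
  (forall x, I x -> continuous w x) ->
  (forall x, I x -> u x * u x + v x * v x = 1) ->
  (forall x, I x -> is_derive u x (- w x * v x)) ->
  (forall x, I x -> is_derive v x (w x * u x)) ->
  exists Phi, is_antiderivative I w Phi /\
    forall x, I x -> u x = cos (Phi x) /\ v x = sin (Phi x).
Proof.
intros HI [x0 H0] Hw H1 Hu Hv.
destruct (unit_vector_angle _ _ (H1 x0 H0)) as [t [Hc Hs]].
destruct (antiderivative_through I w x0 t HI Hw H0) as [Phi [HPhi HPhi0]].
exists Phi. split; [exact HPhi|].
(* The vector [(u, v)] rotated back by the angle [Phi] is constant. *)
assert (E1 : forall x, I x ->
  u x * cos (Phi x) + v x * sin (Phi x) = 1).
{ intros x Hx. rewrite <- (H1 x0 H0).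
  transitivity (u x0 * cos (Phi x0) + v x0 * sin (Phi x0));
    [|now rewrite HPhi0, Hc, Hs].
  apply (zero_derivative_constant I
    (fun x => u x * cos (Phi x) + v x * sin (Phi x)) HI); auto.
  intros y Hy. specialize (HPhi y Hy). specialize (Hu y Hy).
  specialize (Hv y Hy).
  auto_derive; [repeat split; eexists; eassumption|].
  rewrite (is_derive_unique (fun x : R => Phi x) _ _ HPhi),
    (is_derive_unique (fun x : R => u x) _ _ Hu),
    (is_derive_unique (fun x : R => v x) _ _ Hv). ring. }
assert (E2 : forall x, I x ->
  v x * cos (Phi x) - u x * sin (Phi x) = 0).
{ intros x Hx.
  transitivity (v x0 * cos (Phi x0) - u x0 * sin (Phi x0));
    [|rewrite HPhi0, Hc, Hs; ring].
  apply (zero_derivative_constant I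
    (fun x => v x * cos (Phi x) - u x * sin (Phi x)) HI); auto.
  intros y Hy. specialize (HPhi y Hy). specialize (Hu y Hy).
  specialize (Hv y Hy).
  auto_derive; [repeat split; eexists; eassumption|].
  rewrite (is_derive_unique (fun x : R => Phi x) _ _ HPhi),
    (is_derive_unique (fun x : R => u x) _ _ Hu),
    (is_derive_unique (fun x : R => v x) _ _ Hv). ring. }
(* [E1] and [E2] are a linear system for [u x] and [v x] whose matrix is orthogonal with determinant
   of absolute value 1; it is inverted by means of [P]. *)
intros x Hx. specialize (E1 x Hx). specialize (E2 x Hx).
assert (P := sin2_cos2 (Phi x)). unfold Rsqr in P.
set (c := cos (Phi x)) in *. set (s := sin (Phi x)) in *.
split.
- transitivity (u x * (s * s + c * c)); [rewrite P; ring|].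
  transitivity (c * (u x * c + v x * s) - s * (v x * c - u x * s)); [ring|].
  rewrite E1, E2. ring.
- transitivity (v x * (s * s + c * c)); [rewrite P; ring|].
  transitivity (s * (u x * c + v x * s) + c * (v x * c - u x * s)); [ring|].
  rewrite E1, E2. ring.
Qed.

(** * The Darboux frame in coordinates and the normal curvature *)

Lemma is_derive_components (f : R -> vec3) (x : R) (l : vec3) :
  is_derive f x l ->
  is_derive (fun t => c1 (f t)) x (c1 l) /\
  is_derive (fun t => c2 (f t)) x (c2 l) /\
  is_derive (fun t => c3 (f t)) x (c3 l).
Proof.
intros H.
assert (Hfst : is_derive (fun t => fst (f t)) x (fst l)).
{ apply (filterdiff_comp' f fst x _ fst H), filterdiff_linear, is_linear_fst. }
split; [|split].
- apply (filterdiff_comp' (fun t => fst (f t)) fst x _ fst Hfst).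
  apply filterdiff_linear, is_linear_fst.
- apply (filterdiff_comp' (fun t => fst (f t)) snd x _ snd Hfst).
  apply filterdiff_linear, is_linear_snd.
- apply (filterdiff_comp' f snd x _ snd H).
  apply filterdiff_linear, is_linear_snd.
Qed.

Lemma gnorm_isotropic (v : vec3) :
  c1 v = 0 -> gnorm v = sqrt (c2 v * c2 v + c3 v * c3 v).
Proof.
intros H. unfold gnorm, gdot. destruct (Req_EM_T (c1 v) 0); [|easy].
rewrite Rabs_pos_eq; [reflexivity|nra].
Qed.

(** A Galilean cross product has first component 0, so its norm is the Euclidean one of the last two
    components, and dividing by it gives a unit vector of that plane. *)
Lemma unit_normal_coords A p n :
  is_unit_normal A p n -> c1 n = 0 /\ c2 n * c2 n + c3 n * c3 n = 1.
Proof.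
intros (U & phi & q & _ & _ & _ & H).
set (w := gcross _ _) in H. destruct H as [Hw ->].
assert (W : c1 w = 0) by reflexivity.
assert (S : gnorm w * gnorm w = c2 w * c2 w + c3 w * c3 w).
{ rewrite (gnorm_isotropic w W). apply sqrt_sqrt. nra. }
clearbody w. split.
- change (/ gnorm w * c1 w = 0). rewrite W. ring.
- change (/ gnorm w * c2 w * (/ gnorm w * c2 w)
    + / gnorm w * c3 w * (/ gnorm w * c3 w) = 1).
  transitivity (/ gnorm w * / gnorm w * (c2 w * c2 w + c3 w * c3 w)); [ring|].
  rewrite <- S. field. lra.
Qed.

Lemma velocity_c1 I beta x :
  is_open_interval I -> unit_speed_curve I beta -> I x ->
  c1 (curve_derive beta x) = 1.
Proof.
intros [HO _] [_ Hb] Hx. change (Derive (fun t => c1 (beta t)) x = 1).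
rewrite <- (Derive_id x). apply Derive_ext_loc.
apply (filter_imp I); [exact Hb|exact (HO x Hx)].
Qed.

(** [Q] is the normal turned clockwise by a right angle in the plane of the last two coordinates;
    this makes the equation for [n'] a rotation equation. *)
Lemma frame_Q_coords b n x :
  c1 (curve_derive b x) = 1 -> c1 (n x) = 0 ->
  frame_Q b n x = (0, c3 (n x), - c2 (n x)).
Proof.
intros HT Hn. unfold frame_Q, gcross. rewrite HT, Hn.
f_equal; [f_equal|]; ring.
Qed.

(** A constant square alone would let [kn] jump between two signs. Taking the product of the
    acceleration [(p, q)] with the normal [(u, v)] exhibits [kn] as a differentiable function; then
    [2 * kn * kn' = 0] with [kn] nonzero forces [kn' = 0]. *)
Lemma normal_curvature_constant (I : R -> Prop) (kn u v p q : R -> R) (c : R) :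
  is_open_interval I -> 0 < c ->
  (forall x, I x -> u x * u x + v x * v x = 1) ->
  (forall x, I x -> kn x * kn x = c) ->
  (forall x, I x -> p x = kn x * u x /\ q x = kn x * v x) ->
  (forall x, I x -> ex_derive u x /\ ex_derive v x) ->
  (forall x, I x -> ex_derive p x /\ ex_derive q x) ->
  forall x y, I x -> I y -> kn x = kn y.
Proof.
intros HI Hc H1 Hk Hpq Huv Hdpq.
assert (E : forall x, I x -> p x * u x + q x * v x = kn x).
{ intros x Hx. destruct (Hpq x Hx) as [-> ->].
  transitivity (kn x * (u x * u x + v x * v x)); [ring|].
  rewrite (H1 x Hx). ring. }
destruct HI as [HO HC].
assert (Hd : forall x, I x -> is_derive kn x 0).
{ intros x Hx.
  destruct (Huv x Hx) as [Hu Hv], (Hdpq x Hx) as [Hp Hq].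
  assert (D : ex_derive kn x).
  { apply (ex_derive_ext_loc (fun t => p t * u t + q t * v t)).
    - apply (filter_imp I); [exact E|exact (HO x Hx)].
    - auto_derive. repeat split; assumption. }
  destruct D as [l Hl].
  assert (S : is_derive (fun t => kn t * kn t) x (2 * kn x * l)).
  { auto_derive; [repeat split; eexists; exact Hl|].
    rewrite (is_derive_unique (fun t : R => kn t) _ _ Hl). ring. }
  assert (Z : is_derive (fun t => kn t * kn t) x 0).
  { apply (is_derive_ext_loc (fun _ => c)).
    - apply (filter_imp I); [|exact (HO x Hx)].
      intros t Ht. symmetry. now apply Hk.
    - exact (is_derive_const (V := R_NormedModule) c x). }
  assert (L : 2 * kn x * l = 0).
  { rewrite <- (is_derive_unique _ _ _ S). now apply is_derive_unique. }
  specialize (Hk x Hx).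
  destruct (Rmult_integral _ _ L) as [K|K]; [nra|now subst l]. }
apply zero_derivative_constant; [now split|exact Hd].
Qed.

(** * Integration of the position vector *)

Theorem corollary4p5 :
  forall (M : vec3 -> Prop)
         (A : (R * R -> Prop) -> (R * R -> vec3) -> Prop)
         (I : R -> Prop) (beta n : R -> vec3)
         (kappa_g kappa_n tau_g : R -> R),
    is_oriented_surface M A ->
    is_open_interval I ->
    unit_speed_curve I beta ->
    (forall x, I x -> M (beta x)) ->
    (forall x, I x -> 0 < curvature beta x) ->
    is_normal_along A I beta n ->
    Darboux_equations I beta n kappa_g kappa_n tau_g ->
    (forall x, I x -> kappa_g x = 0) ->
    Salkowski I beta ->
    exists (m m1 m2 : R) (Phi Psi C1 C2 S1 S2 : R -> R),
      is_antiderivative I tau_g Phi /\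
      is_antiderivative I (fun x => cos (Phi x) + m1) C1 /\
      is_antiderivative I C1 C2 /\
      is_antiderivative I tau_g Psi /\
      is_antiderivative I (fun x => sin (Psi x) + m2) S1 /\
      is_antiderivative I S1 S2 /\
      (forall x, I x -> beta x = (x, m * C2 x, - m * S2 x)).
Proof.
intros M A I beta n kg kn tau _ HI Hb _ Hpos Hn HD Hg [[c Hcurv] Htor].
(* On an empty [I] the torsion would be constant, with any value such as 0, against the Salkowski
   condition. *)
assert (Hne : exists x0, I x0).
{ apply NNPP. intros N. apply Htor. exists 0. intros x Hx.
  exfalso. apply N. now exists x. }
assert (HIopen := proj1 HI).
set (u := fun x => c2 (n x)). set (v := fun x => c3 (n x)).
set (y := fun x => c2 (beta x)). set (z := fun x => c3 (beta x)).
assert (N0 : forall x, I x -> c1 (n x) = 0).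
{ intros x Hx. exact (proj1 (unit_normal_coords _ _ _ (Hn x Hx))). }
assert (N1 : forall x, I x -> u x * u x + v x * v x = 1).
{ intros x Hx. exact (proj2 (unit_normal_coords _ _ _ (Hn x Hx))). }
assert (HQ : forall x, I x -> frame_Q beta n x = (0, v x, - u x)).
{ intros x Hx. apply frame_Q_coords; [|now apply N0].
  now apply (velocity_c1 I). }
(* The equation for [T'] with zero geodesic curvature, read by components; the type ascriptions
   identify derivatives of the velocity with second derivatives by conversion. *)
assert (DT : forall x, I x -> Derive_n (fun t => c1 (beta t)) 2 x = 0
  /\ Derive_n y 2 x = kn x * u x /\ Derive_n z 2 x = kn x * v x).
{ intros x Hx. destruct (HD x Hx) as [H _].
  apply is_derive_components in H. rewrite (Hg x Hx), (HQ x Hx) in H.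
  destruct H as (A1 & A2 & A3).
  split; [|split];
    [rewrite (is_derive_unique _ _ _ A1 : Derive_n (fun t => c1 (beta t)) 2 x = _)
    |rewrite (is_derive_unique _ _ _ A2 : Derive_n y 2 x = _)
    |rewrite (is_derive_unique _ _ _ A3 : Derive_n z 2 x = _)].
  - change (0 * 0 + kn x * c1 (n x) = 0). rewrite (N0 x Hx). ring.
  - change (0 * v x + kn x * u x = kn x * u x). ring.
  - change (0 * - u x + kn x * v x = kn x * v x). ring. }
assert (Hu : forall x, I x -> is_derive u x (- tau x * v x)).
{ intros x Hx. destruct (HD x Hx) as (_ & _ & H).
  apply is_derive_components in H. rewrite (HQ x Hx) in H. exact (proj1 (proj2 H)). }
assert (Hv : forall x, I x -> is_derive v x (tau x * u x)).
{ intros x Hx. destruct (HD x Hx) as (_ & _ & H).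
  apply is_derive_components in H. rewrite (HQ x Hx) in H.
  replace (tau x * u x) with (- tau x * - u x) by ring. exact (proj2 (proj2 H)). }
(* The acceleration is [kn] times a unit normal, so the squared curvature is the square of [kn]. *)
assert (Hk : forall x, I x -> kn x * kn x = c * c).
{ intros x Hx. rewrite <- (Hcurv x Hx).
  destruct (DT x Hx) as (A1 & A2 & A3). unfold curvature.
  rewrite (gnorm_isotropic (curve_derive (curve_derive beta) x) A1), sqrt_sqrt by nra.
  change (kn x * kn x = Derive_n y 2 x * Derive_n y 2 x
    + Derive_n z 2 x * Derive_n z 2 x).
  rewrite A2, A3.
  transitivity (kn x * kn x * (u x * u x + v x * v x)); [|ring].
  rewrite (N1 x Hx). ring. }
destruct Hb as [[_ [Cy Cz]] Hbx]. fold y in Cy. fold z in Cz.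
destruct Hne as [x0 H0].
assert (Hc : 0 < c) by (rewrite <- (Hcurv x0 H0); now apply Hpos).
assert (Hconst : forall x, I x -> kn x = kn x0).
{ intros x Hx.
  apply (normal_curvature_constant I kn u v (Derive_n y 2) (Derive_n z 2)
    (c * c)); auto.
  - nra.
  - intros t Ht. exact (proj2 (DT t Ht)).
  - intros t Ht. split; eexists; [apply Hu|apply Hv]; exact Ht.
  (* Existence of a third derivative unfolds to differentiability of [Derive_n y 2] and
     [Derive_n z 2]. *)
  - intros t Ht. split;
      [apply (proj1 (Cy t Ht) 3%nat)|apply (proj1 (Cz t Ht) 3%nat)];
      apply le_n. }
set (m := kn x0) in *.
assert (Hm : m <> 0).
{ specialize (Hk x0 H0). fold m in Hk. nra. }
assert (Y2 : forall x, I x -> Derive_n y 2 x = m * u x).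
{ intros x Hx. rewrite <- (Hconst x Hx). apply DT, Hx. }
assert (Z2 : forall x, I x -> Derive_n z 2 x = m * v x).
{ intros x Hx. rewrite <- (Hconst x Hx). apply DT, Hx. }
assert (Y3 : forall x, I x -> Derive_n y 3 x = m * (- tau x * v x)).
{ intros x Hx. change (Derive (Derive_n y 2) x = m * (- tau x * v x)).
  rewrite <- (is_derive_unique _ _ _ (Hu x Hx)), <- Derive_scal.
  apply Derive_ext_loc. apply (filter_imp I); [exact Y2|exact (HIopen x Hx)]. }
assert (Z3 : forall x, I x -> Derive_n z 3 x = m * (tau x * u x)).
{ intros x Hx. change (Derive (Derive_n z 2) x = m * (tau x * u x)).
  rewrite <- (is_derive_unique _ _ _ (Hv x Hx)), <- Derive_scal.
  apply Derive_ext_loc. apply (filter_imp I); [exact Z2|exact (HIopen x Hx)]. }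
(* Continuity of the geodesic torsion comes from the class C^3 of the curve: since [(u, v)] is a
   unit vector, [u * z''' - v * y'''] equals [m * tau]. *)
assert (Htau : forall x, I x -> continuous tau x).
{ intros x Hx.
  apply (continuous_ext_loc tau
    (fun t => / m * (u t * Derive_n z 3 t - v t * Derive_n y 3 t))).
  - apply (filter_imp I); [|exact (HIopen x Hx)].
    intros t Ht. rewrite (Y3 t Ht), (Z3 t Ht).
    change (/ m * (u t * (m * (tau t * u t)) - v t * (m * (- tau t * v t)))
      = tau t).
    transitivity (tau t * (u t * u t + v t * v t)); [field; exact Hm|].
    rewrite (N1 t Ht). ring.
  - apply (continuous_scal_r (V := R_NormedModule) (/ m)).
    apply (continuous_minus (V := R_NormedModule));
      apply (continuous_mult (K := R_AbsRing)).
    + apply (ex_derive_continuous (V := R_NormedModule)).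
      eexists; exact (Hu x Hx).
    + exact (proj2 (Cz x Hx)).
    + apply (ex_derive_continuous (V := R_NormedModule)).
      eexists; exact (Hv x Hx).
    + exact (proj2 (Cy x Hx)). }
destruct (rotating_unit_vector I u v tau HI (ex_intro _ x0 H0) Htau N1 Hu Hv)
  as [Phi [HPhi Huv]].
assert (D1y : forall x, I x -> is_derive y x (Derive y x)
  /\ is_derive (Derive y) x (m * cos (Phi x))).
{ intros x Hx. destruct (Cy x Hx) as [H _]. split.
  - apply Derive_correct. exact (H 1%nat ltac:(auto)).
  - rewrite <- (proj1 (Huv x Hx)), <- (Y2 x Hx).
    apply (Derive_correct (Derive y)). exact (H 2%nat ltac:(auto)). }
assert (D1z : forall x, I x -> is_derive z x (Derive z x)
  /\ is_derive (Derive z) x (m * sin (Phi x))).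
{ intros x Hx. destruct (Cz x Hx) as [H _]. split.
  - apply Derive_correct. exact (H 1%nat ltac:(auto)).
  - rewrite <- (proj2 (Huv x Hx)), <- (Z2 x Hx).
    apply (Derive_correct (Derive z)). exact (H 2%nat ltac:(auto)). }
(* The iterated antiderivatives are read off from the curve itself, as [y'], [y], [z'], [z] divided
   by [m] or [- m], so they already carry the right integration constants; [m1] and [m2] are set to
   0. The shift by [PI] changes the sign of the sine, as the factor [- m] requires. *)
exists m, 0, 0, Phi, (fun x => Phi x + PI),
  (fun x => / m * Derive y x), (fun x => / m * y x),
  (fun x => - / m * Derive z x), (fun x => - / m * z x).
split; [|split; [|split; [|split; [|split; [|split]]]]]; intros x Hx.
- now apply HPhi.
- replace (cos (Phi x) + 0) with (/ m * (m * cos (Phi x))) by (field; exact Hm).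
  apply (is_derive_scal (Derive y)), D1y, Hx.
- apply is_derive_scal, D1y, Hx.
- replace (tau x) with (tau x + 0) by ring.
  apply (is_derive_plus (V := R_NormedModule)); [now apply HPhi|].
  exact (is_derive_const (V := R_NormedModule) PI x).
- rewrite neg_sin.
  replace (- sin (Phi x) + 0) with (- / m * (m * sin (Phi x)))
    by (field; exact Hm).
  apply (is_derive_scal (Derive z)), D1z, Hx.
- apply is_derive_scal, D1z, Hx.
- rewrite (surjective_pairing (beta x)), (surjective_pairing (fst (beta x))).
  change ((c1 (beta x), y x, z x)
    = (x, m * (/ m * y x), - m * (- / m * z x))).
  rewrite (Hbx x Hx). f_equal; [f_equal|]; field; exact Hm.
Qed.
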